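(* Let $(W,S)$ be a Coxeter system with $S$ finite. Then the generalized pure cactus group $PC_W=\ker(g_W)$ is isomorphic to a subgroup of the right-angled Coxeter group $\mathbb W$ (with generating set $\{\tau_{W'}:W'\in\mathbb S\}$) defined below.
   Context: For a Coxeter system $(W,S)$ and $I\subset S$, $W_I$ is the subgroup generated by $I$; when $W_I$ is finite, $w_I$ is its longest element. A nonempty $I\subset S$ is connected if $W_I$ is finite and there is no decomposition $I=J\cup K$ with $J,K$ disjoint nonempty and $W_I=W_J\times W_K$ (every element of $J$ commutes with every element of $K$). $\mathcal F(S)$ is the set of connected subsets. For $I\subset J$ with $W_J$ finite, $w_J(I):=\{w_Jsw_J:s\in I\}\subset S$. The generalized cactus group $C_W$ is generated by $\{\gamma_I:I\in\mathcal F(S)\}$ with relations $\gamma_I^2=1$, and $\gamma_I\gamma_J=\gamma_J\gamma_{w_J(I)}$ whenever $I\subset J$ or $W_{I\cup J}=W_I\times W_J$. The homomorphism $g_W:C_W\to W$ is $\gamma_I\mapsto w_I$, and $PC_W:=\ker g_W$. Let $\mathbb S:=\{wW_Iw^{-1}: w\in W, I\in\mathcal F(S)\}$ (a set of subgroups of $W$). For $W',W''\in\mathbb S$ put $m(W',W'')=1$ if $W'=W''$; $m(W',W'')=2$ if $W'\subsetneq W''$ or $W''\subsetneq W'$, or if $W'\cap W''=\{1\}$ and every element of $W''$ commutes with every element of $W'$; and $m(W',W'')=\infty$ otherwise. $\mathbb W$ is the Coxeter group generated by symbols $\tau_{W'}$, $W'\in\mathbb S$, with relations $\tau_{W'}^2=1$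 and $(\tau_{W'}\tau_{W''})^2=1$ whenever $m(W',W'')=2$. *)

(* Defs.v *)
From Stdlib Require List.
From mathcomp Require Import all_boot.
Set Implicit Arguments. Unset Strict Implicit. Unset Printing Implicit Defensive.

Record grp := Grp {
  gcar :> Type;
  gmul : gcar -> gcar -> gcar;
  gone : gcar;
  ginv : gcar -> gcar;
  gmulA : forall x y z, gmul x (gmul y z) = gmul (gmul x y) z;
  gmul1 : forall x, gmul gone x = x;
  gmulV : forall x, gmul (ginv x) x = gone
}.
Arguments gmul {g}. Arguments gone {g}. Arguments ginv {g}.

Definition is_hom (G H : grp) (f : G -> H) : Prop :=
  forall x y, f (gmul x y) = gmul (f x) (f y).

(** words in generators indexed by X: (true, x) stands for x^-1 *)
Definition word (X : Type) := seq (bool * X).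
Definition eval (X : Type) (G : grp) (y : X -> G) (l : word X) : G :=
  foldr (fun p acc => gmul (if p.1 then ginv (y p.2) else y p.2) acc) gone l.

Definition is_presentation (X : Type) (G : grp) (x : X -> G)
  (R : word X -> word X -> Prop) : Prop :=
  [/\ forall g : G, exists l, eval x l = g,
      forall l r, R l r -> eval x l = eval x r &
      forall (H : grp) (y : X -> H), (forall l r, R l r -> eval y l = eval y r) ->
        exists f : G -> H, is_hom f /\ forall a, f (x a) = y a].

Definition gen_sub (G : grp) (A : G -> Prop) (g : G) : Prop :=
  exists l : seq (bool * G), (forall p, List.In p l -> A p.2) /\ eval id l = g.

Definition finite_sub (G : grp) (P : G -> Prop) : Prop :=
  exists l : seq G, forall g, P g -> List.In g l.

Definition direct_prod (G : grp) (A B C : G -> Prop) : Prop :=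
  [/\ forall c, C c <-> exists a b, A a /\ B b /\ c = gmul a b,
      forall a b, A a -> B b -> gmul a b = gmul b a &
      forall x, A x -> B x -> x = gone].

(** * Coxeter systems (W,S), S finite, indexed by the finType S via s : S -> W;
    Coxeter matrix m with the convention m s t = 0 for infinity. *)
Section Coxeter.
Variables (S : finType) (W : grp) (s : S -> W).

Definition coxeter_matrix (m : S -> S -> nat) : Prop :=
  [/\ forall i, m i i = 1, forall i j, m i j = m j i &
      forall i j, i != j -> m i j != 1].

Definition coxeter_rel (m : S -> S -> nat) (l r : word S) : Prop :=
  exists i j, m i j != 0 /\ r = [::] /\
    l = flatten (nseq (m i j) [:: (false, i); (false, j)]).

Definition is_coxeter_system (m : S -> S -> nat) : Prop :=
  coxeter_matrix m /\ is_presentation s (coxeter_rel m).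

Definition parab (I : {set S}) : W -> Prop :=
  gen_sub (fun x => exists2 i, i \in I & x = s i).

Definition has_length (w : W) (n : nat) : Prop :=
  (exists l : seq S, size l = n /\ eval s [seq (false, i) | i <- l] = w) /\
  (forall l : seq S, eval s [seq (false, i) | i <- l] = w -> n <= size l).

Definition is_longest (I : {set S}) (w : W) : Prop :=
  parab I w /\ exists n, has_length w n /\
    forall v k, parab I v -> has_length v k -> k <= n.

Definition connected (I : {set S}) : Prop :=
  [/\ I != set0, finite_sub (parab I) &
      ~ exists J K : {set S}, [/\ J :|: K = I, J :&: K = set0, J != set0, K != set0 &
          forall j k, j \in J -> k \in K -> gmul (s j) (s k) = gmul (s k) (s j)]].

Definition FS := {I : {set S} | connected I}.

(** relations of the generalized cactus group C_W (generators gamma_I, I in F(S)):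
    gamma_I^2 = 1, and gamma_I gamma_J = gamma_J gamma_{w_J(I)} whenever I subset J
    or W_{I u J} = W_I x W_J; here K = w_J(I) = { t | s_t = w_J s_i w_J, i in I }. *)
Definition cactus_rel (l r : word FS) : Prop :=
  (exists I : FS, l = [:: (false, I); (false, I)] /\ r = [::]) \/
  (exists (I J K : FS) (wJ : W),
     [/\ proj1_sig I \subset proj1_sig J \/
           direct_prod (parab (proj1_sig I)) (parab (proj1_sig J)) (parab (proj1_sig I :|: proj1_sig J)),
         is_longest (proj1_sig J) wJ,
         (forall t, t \in proj1_sig K <-> exists2 i, i \in proj1_sig I & s t = gmul wJ (gmul (s i) wJ)),
         l = [:: (false, I); (false, J)] &
         r = [:: (false, J); (false, K)]]).

(** the set SS = { w W_I w^-1 : w in W, I in F(S) }, indexed (redundantly) by pairs *)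
Definition SSidx := (W * FS)%type.
Definition SSsub (a : SSidx) : W -> Prop :=
  fun x => exists2 y, parab (proj1_sig a.2) y & x = gmul a.1 (gmul y (ginv a.1)).

Definition sub_eq (P Q : W -> Prop) := forall x, P x <-> Q x.
Definition strict_sub (P Q : W -> Prop) :=
  (forall x, P x -> Q x) /\ exists2 x, Q x & ~ P x.
Definition m_is_2 (P Q : W -> Prop) : Prop :=
  strict_sub P Q \/ strict_sub Q P \/
  ((forall x, P x -> Q x -> x = gone) /\ forall x y, P x -> Q y -> gmul y x = gmul x y).

(** relations of the right-angled Coxeter group WW with generators tau_{W'}, W' in SS;
    generators indexed by pairs defining the same subgroup are identified. *)
Definition racg_rel (l r : word SSidx) : Prop :=
  (exists a b, sub_eq (SSsub a) (SSsub b) /\ l = [:: (false, a)] /\ r = [:: (false, b)]) \/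
  (exists a, l = [:: (false, a); (false, a)] /\ r = [::]) \/
  (exists a b, m_is_2 (SSsub a) (SSsub b) /\
     l = [:: (false, a); (false, b); (false, a); (false, b)] /\ r = [::]).

End Coxeter.

(* Main.v *)
(* Right multiplication gives an action of C_W on the set WW * W, in which gamma_I sends
   (x, w) to (x tau_P, w w_I) with P = w W_I w^-1; the first coordinate f c of the image of
   (1, 1) under c is multiplicative on the kernel of g.  Conversely, WW acts on the set C_W:
   tau_P sends c to c gamma_I if P = g(c) W_I g(c)^-1 for some (then unique) I, and fixes c
   if there is no such I; the cactus relations are exactly what makes commuting generators
   of WW act by commuting permutations.  The second action applied to 1 recovers c from f c,
   so f is injective, and no normal form in the right-angled group is needed.

   The Coxeter group input is W_I <= W_J -> I <= J, the uniqueness of w_J and w_J J w_J = J.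
   It follows from the exchange condition, obtained as in Bourbaki from an action of W on
   W * {+1, -1}, and from the distinctness of the generators, obtained from a reflection
   representation over the algebraic numbers. *)
Require Import Defs.
From mathcomp Require Import all_boot.
From mathcomp Require Import boolp ssralg ssrnum poly algC cyclotomic.
From mathcomp Require Import ring.

Set Implicit Arguments. Unset Strict Implicit. Unset Printing Implicit Defensive.

Local Infix "**" := gmul (at level 40, left associativity).

(** * Elementary group theory *)

Section GroupTheory.
Variable G : grp.
Implicit Types x y z : G.

Lemma grp_mulgV x : x ** ginv x = gone.
Proof.
rewrite -[x ** _]gmul1 -{1}(gmulV (ginv x)) -gmulA (gmulA (ginv x)) gmulV gmul1.
exact: gmulV.
Qed.

Lemma grp_mulg1 x : x ** gone = x.
Proof. by rewrite -(gmulV x) gmulA grp_mulgV gmul1. Qed.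

Lemma grp_mulgK x y : x ** y ** ginv y = x.
Proof. by rewrite -gmulA grp_mulgV grp_mulg1. Qed.

Lemma grp_mulgVK x y : x ** ginv y ** y = x.
Proof. by rewrite -gmulA gmulV grp_mulg1. Qed.

Lemma grp_mulgI x y z : x ** y = x ** z -> y = z.
Proof. by move=> e; rewrite -[y]gmul1 -(gmulV x) -gmulA e gmulA gmulV gmul1. Qed.

Lemma grp_mulIg x y z : y ** x = z ** x -> y = z.
Proof. by move=> e; rewrite -(grp_mulgK y x) e grp_mulgK. Qed.

Lemma grp_inv_uniq x y : x ** y = gone -> ginv x = y.
Proof. by move=> e; apply: (@grp_mulgI x); rewrite grp_mulgV e. Qed.

Lemma grp_invMg x y : ginv (x ** y) = ginv y ** ginv x.
Proof. by apply: grp_inv_uniq; rewrite gmulA grp_mulgK grp_mulgV. Qed.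

Lemma grp_invg1 : ginv (gone : G) = gone.
Proof. by apply: grp_inv_uniq; rewrite gmul1. Qed.

Lemma grp_conjgK w x : ginv w ** (w ** x ** ginv w) ** w = x.
Proof. by rewrite !gmulA gmulV gmul1 grp_mulgVK. Qed.

Lemma grp_conj_mul w x y :
  w ** (x ** ginv w) ** (w ** (y ** ginv w)) = w ** (x ** y ** ginv w).
Proof. by rewrite !gmulA grp_mulgVK. Qed.

Lemma mul_involK z x : z ** z = gone -> x ** z ** z = x.
Proof. by move=> zz; rewrite -gmulA zz grp_mulg1. Qed.

Lemma mul_involKV z x : z ** z = gone -> z ** (z ** x) = x.
Proof. by move=> zz; rewrite gmulA zz gmul1. Qed.

Lemma invol_conjK z x : z ** z = gone -> z ** (z ** x ** z) ** z = x.
Proof. by move=> zz; rewrite !gmulA zz gmul1 mul_involK. Qed.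

Lemma eval_cat (X : Type) (y : X -> G) l r : eval y (l ++ r) = eval y l ** eval y r.
Proof. by elim: l => [|p l IH] /=; rewrite ?gmul1 // IH gmulA. Qed.

End GroupTheory.

Lemma hom_one (G H : grp) (f : G -> H) : is_hom f -> f gone = gone.
Proof. by move=> fM; apply: (@grp_mulgI _ (f gone)); rewrite -fM gmul1 grp_mulg1. Qed.

(** * Groups presented by involutions: induction and actions *)

Section InvolutiveGenerators.
Variables (X : Type) (G : grp) (x : X -> G) (R : word X -> word X -> Prop).
Hypothesis GP : is_presentation x R.

Lemma presentation_ind (P : G -> Prop) :
  (forall a, x a ** x a = gone) ->
  P gone -> (forall g a, P g -> P (g ** x a)) -> forall g, P g.
Proof.
move=> xx P1 PM g; have [gen _ _] := GP; have [l <-] := gen g.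
rewrite -[eval x l]gmul1; elim: l {g} gone P1 => [|[b a] l IH] h Ph /=.
  by rewrite grp_mulg1.
have -> : (if b then ginv (x a) else x a) = x a.
  by case: b => //; apply: grp_inv_uniq.
by rewrite gmulA; apply/IH/PM.
Qed.

Section Action.
Variable T : Type.

Record bijection := Bijection {
  bij_fun : T -> T;
  bij_inv : T -> T;
  bij_funK : cancel bij_fun bij_inv;
  bij_invK : cancel bij_inv bij_fun }.

Lemma bijection_eq p q : bij_fun p =1 bij_fun q -> p = q.
Proof.
case: p q => [f f' fK f'K] [h h' hK h'K] /= /funext fh; subst h.
have e : f' = h' by apply: funext => t; rewrite -{1}(h'K t) fK.
by subst h'; congr Bijection; apply: Prop_irrelevance.
Qed.

Definition bijection_one := @Bijection id id (fun=> erefl) (fun=> erefl).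

Definition bijection_inv p := Bijection (@bij_invK p) (@bij_funK p).

(* Composed in diagrammatic order, so that the action on T is a right action. *)
Definition bijection_mul p q :=
  Bijection (can_comp (@bij_funK q) (@bij_funK p)) (can_comp (@bij_invK p) (@bij_invK q)).

Lemma bijection_mulA p q r :
  bijection_mul p (bijection_mul q r) = bijection_mul (bijection_mul p q) r.
Proof. exact: bijection_eq. Qed.

Lemma bijection_mul1 p : bijection_mul bijection_one p = p.
Proof. exact: bijection_eq. Qed.

Lemma bijection_mulV p : bijection_mul (bijection_inv p) p = bijection_one.
Proof. by apply: bijection_eq => t /=; rewrite bij_invK. Qed.

Definition bijection_grp : grp := Grp bijection_mulA bijection_mul1 bijection_mulV.

Definition run (y : X -> T -> T) (l : word X) (t : T) : T := foldl (fun t p => y p.2 t) t l.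

(** The universal property is applied to the group of bijections of [T], so only the relations have
    to be checked, pointwise. *)
Lemma presentation_action (y : X -> T -> T) :
  (forall a, involutive (y a)) ->
  (forall l r, R l r -> forall t, run y l t = run y r t) ->
  exists act : G -> T -> T,
    [/\ forall t, act gone t = t,
        forall g h t, act (g ** h) t = act h (act g t) &
        forall a t, act (x a) t = y a t].
Proof.
move=> yK yR; have [_ _ univ] := GP.
pose b a : bijection_grp := Bijection (yK a) (yK a).
have evalE l t : bij_fun (eval b l) t = run y l t.
  by elim: l t => [|[[] a] l IH] t //=; rewrite IH.
have [l r lr|f [fM fx]] := univ bijection_grp b.
  by apply: bijection_eq => t; rewrite !evalE; apply: yR.
exists (fun g => bij_fun (f g)); split=> [t|g h t|a t]; last by rewrite fx.
  by rewrite (hom_one fM).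
by rewrite fM.
Qed.

End Action.
End InvolutiveGenerators.

(** * Coxeter systems *)

Section CoxeterTheory.
Variables (S : finType) (W : grp) (s : S -> W) (m : S -> S -> nat).
Hypothesis WP : is_coxeter_system s m.

Local Notation ev l := (eval s [seq (false, i) | i <- l]).

Lemma cox_rel_eval i j : m i j != 0 ->
  eval s (flatten (nseq (m i j) [:: (false, i); (false, j)])) = gone.
Proof. by case: WP => _ [_ rel _] mij; rewrite (rel _ [::]) //; exists i, j. Qed.

Lemma cox_genK i : s i ** s i = gone.
Proof.
have [[m1 _ _] _] := WP.
by move: (@cox_rel_eval i i); rewrite m1 /= grp_mulg1; apply.
Qed.

Lemma mul_cox_genK w i : w ** s i ** s i = w.
Proof. exact: mul_involK (cox_genK i). Qed.

Definition cox_genE := (@gmulA W, cox_genK, @gmul1 W, mul_cox_genK).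

Lemma cox_ind (P : W -> Prop) :
  P gone -> (forall w i, P w -> P (w ** s i)) -> forall w, P w.
Proof. by case: WP => _ WP'; apply: (presentation_ind WP'); apply: cox_genK. Qed.

Lemma ev_cat l r : ev (l ++ r) = ev l ** ev r.
Proof. by rewrite map_cat eval_cat. Qed.

Lemma ev_surj w : exists l, ev l = w.
Proof.
elim/cox_ind: w => [|w i [l <-]]; first by exists [::].
by exists (rcons l i); rewrite -cats1 ev_cat /= grp_mulg1.
Qed.

(** * Generators of a Coxeter system are distinct *)

Section GeometricRepresentation.
Import GRing.Theory.
Local Open Scope ring_scope.

Section Rank2.
Variables (c : S -> S -> algC) (i j : S) (n : nat) (u : algC).
Hypotheses (cii : c i i = - 2%:R) (cjj : c j j = - 2%:R).
Hypotheses (cij : c i j = u + u^-1) (cji : c j i = u + u^-1).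
Hypotheses (u0 : u != 0) (uu1 : u ^+ 2 != 1) (u2n : u ^+ (2 * n) = 1).

(** Functions on [S] are linear forms on the root space; this is the dual of the reflection sending
    the root of [l] to itself plus [c k l] times the root of [k]. *)
Let refl (k : S) (f : S -> algC) (l : S) := f l + c k l * f k.

(* In terms of the rows c_i, c_j of c, the vectors A = u^-1 c_i + c_j and
   B = u c_i + c_j are eigenvectors of the product of the two reflections,
   complementary to its fixed space. *)
Let A (l : S) := u^-1 * c i l + c j l.
Let B (l : S) := u * c i l + c j l.
Let comb (f : S -> algC) (a b : algC) (l : S) := f l + a * A l + b * B l.

Lemma rank2_step f a b : f i = 0 -> f j = 0 ->
  refl j (refl i (comb f a b)) = comb f (a * u ^+ 2) (b * u ^- 2).
Proof.
move=> fi fj; apply: funext => l.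
rewrite /refl /comb /A /B fi fj cii cjj cij cji; field; exact: u0.
Qed.

Lemma rank2_iter f a b k : f i = 0 -> f j = 0 ->
  iter k (refl j \o refl i) (comb f a b) = comb f (a * u ^+ (2 * k)) (b * u ^- (2 * k)).
Proof.
move=> fi fj; elim: k => [|k IH]; first by rewrite muln0 expr0 invr1 !mulr1.
by rewrite iterS IH /= rank2_step // mulnSr !exprD !invfM -!mulrA.
Qed.

(** Forms vanishing at [i] and [j] are fixed, and on [A] and [B] the eigenvalues are [u ^+ 2] and
    [u ^- 2], whose [n]-th powers are 1. *)
Lemma rank2_order f : iter n (refl j \o refl i) f = f.
Proof.
pose D := u - u^-1.
have D0 : D ^+ 2 != 0.
  rewrite expf_neq0 // subr_eq0; apply: contra uu1 => /eqP e.
  by rewrite expr2 {1}e mulVf.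
(* These solve the linear system [f0 i = f0 j = 0], invertible because [u ^+ 2 != 1]. *)
pose a := (u * f i + f j) / D ^+ 2; pose b := (u^-1 * f i + f j) / D ^+ 2.
pose f0 l := f l - a * A l - b * B l.
have fE : f = comb f0 a b by apply: funext => l; rewrite /comb /f0; ring.
have Dn : (u * u - 1) != 0 by rewrite subr_eq0 -expr2.
have fi : f0 i = 0.
  by rewrite /f0 /a /b /A /B /D cii cji; field; rewrite u0 Dn.
have fj : f0 j = 0.
  by rewrite /f0 /a /b /A /B /D cjj cij; field; rewrite u0 Dn.
by rewrite {1}fE rank2_iter // u2n invr1 !mulr1 -fE.
Qed.

End Rank2.

Lemma run_flatten_nseq (T : Type) (y : S -> T -> T) i j n t :
  run y (flatten (nseq n [:: (false, i); (false, j)])) t = iter n (y j \o y i) t.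
Proof. by elim: n t => // n IH t; rewrite iterSr -IH. Qed.

Lemma geometric_representation :
  exists (c : S -> S -> algC) (act : W -> (S -> algC) -> S -> algC),
  [/\ forall i, c i i = - 2%:R,
      forall f, act gone f = f &
      forall i f l, act (s i) f l = f l + c i l * f i].
Proof.
have [[m1 msym mneq1] WP'] := WP.
have roots n : exists u : algC, (1 < n)%N -> [/\ u != 0, u ^+ 2 != 1 & u ^+ (2 * n) = 1].
  (* The default also serves [n = 0], the code for infinity: it makes the entry [c i j] zero, and no
     relation constrains such a pair. *)
  have [n1|n1] := ltnP 1 n; last by exists 0.
  have n0 : (0 < 2 * n)%N by rewrite muln_gt0 (ltnW n1).
  have [u uP] := C_prim_root_exists n0.
  exists u => _; split; last exact: prim_expr_order.
    have : u ^+ (2 * n) != 0 by rewrite (prim_expr_order uP) oner_neq0.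
    by apply: contraNneq => ->; rewrite expr0n muln_eq0 /= -leqn0 leqNgt (ltnW n1).
  rewrite -(prim_order_dvd uP); apply/negP => /dvdn_leq -/(_ isT).
  by rewrite leqNgt -{1}[2%N]muln1 ltn_pmul2l // n1.
have [u uP] := choice roots.
pose c i j := if i == j then - 2%:R else u (m i j) + (u (m i j))^-1.
have cii i : c i i = - 2%:R by rewrite /c eqxx.
pose refl (k : S) (f : S -> algC) (l : S) := f l + c k l * f k.
have reflK k : involutive (refl k).
  by move=> f; apply: funext => l; rewrite /refl cii; ring.
case: (presentation_action WP' reflK _) => [l r [i [j [mij [-> ->]]]] f|act [act1 _ actE]]; last first.
  by exists c, act; split=> // i f l; rewrite actE.
rewrite run_flatten_nseq /=; have [<-|nij] := eqVneq i j.
  by rewrite m1 /= reflK.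
have [u0 u2 un] : [/\ u (m i j) != 0, u (m i j) ^+ 2 != 1 & u (m i j) ^+ (2 * m i j) = 1].
  by apply: uP; rewrite ltn_neqAle eq_sym mneq1 //= lt0n.
by apply: (@rank2_order c i j _ (u (m i j))) => //; rewrite /c 1?msym ?[j == i]eq_sym (negPf nij).
Qed.

Lemma cox_gen_neq1 i : s i <> gone.
Proof.
have [c [act [cii act1 actE]]] := geometric_representation.
move=> e; have := actE i (fun l => (l == i)%:R) i.
rewrite e act1 cii eqxx mulr1 => /esym/eqP; rewrite -subr_eq0 addrAC subrr add0r oppr_eq0.
by rewrite Num.Theory.pnatr_eq0.
Qed.

(** Evaluated at [i], the image of the indicator of [i] is -1 under [s i] but 1 under every other
    generator. *)
Lemma cox_gen_inj : injective s.
Proof.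
have [c [act [cii act1 actE]]] := geometric_representation.
move=> i j e; have [//|nij] := eqVneq i j.
have := actE i (fun l => (l == i)%:R) i.
rewrite e actE cii eqxx mulr1 eq_sym (negPf nij) mulr0 addr0 => /eqP.
rewrite -subr_eq0 opprD addrA subrr add0r opprK.
by rewrite Num.Theory.pnatr_eq0.
Qed.

End GeometricRepresentation.

(** * Exchange condition *)

(* Bourbaki's sign: eta w t is the parity of the number of occurrences of t among
   the reflections s_1 ... s_(k-1) s_k s_(k-1) ... s_1 of any word s_1 ... s_q for w. *)
Lemma reflection_cocycle : exists eta : W -> W -> bool,
  (forall t, eta gone t = false) /\
  forall i w t, eta (s i ** w) t = `[< t = s i >] (+) eta w (s i ** t ** s i).
Proof.
have [_ WP'] := WP.
pose y i (p : W * bool) := (s i ** p.1 ** s i, p.2 (+) `[< p.1 = s i >]).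
have yK i : involutive (y i).
  move=> [t e]; rewrite /y /= !cox_genE.
  congr pair; rewrite -addbA -[RHS]addbF; congr addb.
  suff -> : `[< s i ** t ** s i = s i >] = `[< t = s i >] by rewrite addbb.
  apply/asbool_equiv_eq; split=> [e'|->]; last by rewrite cox_genK gmul1.
  have := congr1 (fun z => s i ** z ** s i) e'.
  by rewrite !cox_genE.
case: (presentation_action WP' yK _) => [l l' [i [j [mij [-> ->]]]] [t e]|act [act1 actM actE]].
  have rel := cox_rel_eval mij; move: (m i j) rel {mij} => n.
  pose r := s i ** s j.
  pose pw k : W := iter k (gmul r) gone.
  have pwE k : eval s (flatten (nseq k [:: (false, i); (false, j)])) = pw k.
    by elim: k => //= k ->; rewrite gmulA.
  have pwD a b : pw (a + b) = pw a ** pw b.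
    by elim: a => [|a IH]; rewrite ?gmul1 // addSn /pw !iterS -/(pw _) IH gmulA.
  have rV : ginv r = s j ** s i.
    by apply: grp_inv_uniq; rewrite /r !cox_genE.
  rewrite pwE => pwn.
  (* The [2 * k] elements [pw h ** s i] are the reflections met along the alternating word; the sign
     changes by the parity of the occurrences of [t] among them. *)
  have runE k : forall t e, run y (flatten (nseq k [:: (false, i); (false, j)])) (t, e) =
      (ginv (pw k) ** t ** pw k,
       e (+) \big[addb/false]_(0 <= h < 2 * k) `[< t = pw h ** s i >]).
    elim: k => [|k IH] t' e'.
      by rewrite big_nil addbF /= grp_invg1 gmul1 grp_mulg1.
    rewrite [run _ _ _]/= IH {IH} /=; congr pair.
      by rewrite -/(pw k) grp_invMg rV !gmulA.
    rewrite mulnS -!addbA; congr addb; rewrite [RHS]big_ltn // [in RHS]big_ltn //; congr addb.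
      by rewrite /= gmul1.
    congr addb.
      apply/asbool_equiv_eq; rewrite /= grp_mulg1; split=> [e1|->].
        by rewrite /r -e1 !cox_genE.
      by rewrite !cox_genE.
    rewrite [RHS](big_addn 0 _ 2) addKn; apply: eq_big_nat => h _.
    rewrite addn2; apply/asbool_equiv_eq; rewrite /= -/(pw h).
    (* Conjugating [t'] by [s i] and then by [s j] turns the condition at [h] into the condition at
       [h + 2]. *)
    have shift z : s j ** (s i ** t' ** s i) ** s j = z ** s i <-> t' = r ** (z ** s i ** s j ** s i).
      split=> [e1|->].
        by rewrite /r -e1 !cox_genE.
      by rewrite /r !cox_genE.
    rewrite shift.
    have pwr : pw h ** r = r ** pw h.
      by rewrite -[r ** _]/(pw h.+1) -addn1 pwD /= grp_mulg1.
    by rewrite -[_ ** s i ** s j]gmulA -/r pwr !gmulA.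
  rewrite runE pwn grp_invg1 gmul1 grp_mulg1 /=; congr pair.
  (* Since [pw n = gone], the reflections with [n <= h < 2 * n] repeat those with [h < n], and the
     parities cancel. *)
  rewrite mul2n -addnn (@big_cat_nat _ _ _ n) //= ?leq_addr //.
  have -> : \big[addb/false]_(n <= h < n + n) `[< t = pw h ** s i >] =
            \big[addb/false]_(0 <= h < n) `[< t = pw h ** s i >].
    rewrite -{1}[n]add0n big_addn addnK; apply: eq_bigr => h _.
    by rewrite pwD pwn grp_mulg1.
  by rewrite addbb addbF.
have flip w t e : act w (t, e) = ((act w (t, false)).1, e (+) (act w (t, false)).2).
  elim/cox_ind: w => [|w i IH]; first by rewrite !act1 addbF.
  by rewrite !actM !actE IH /y /= addbA.
exists (fun w t => (act w (t, false)).2); split=> [t|i w t]; first by rewrite act1.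
by rewrite actM actE /y /= flip.
Qed.

(** An odd count is nonzero, so [t] is a reflection of the word, and multiplying by it removes the
    corresponding letter. *)
Lemma deletion eta l t :
  (forall t, eta gone t = false) ->
  (forall i w t, eta (s i ** w) t = `[< t = s i >] (+) eta w (s i ** t ** s i)) ->
  eta (ev l) t -> exists l1 j l2, l = l1 ++ j :: l2 /\ t ** ev l = ev (l1 ++ l2).
Proof.
move=> eta1 etaE; elim: l t => [|i l IH] t /=; first by rewrite eta1.
rewrite etaE; case: asboolP => [-> _|_ /= /IH [l1 [j [l2 [-> e]]]]].
  by exists [::], i, l; rewrite !cox_genE.
exists (i :: l1), j, l2; split=> //=; rewrite -e.
by rewrite !cox_genE.
Qed.

Definition reduced (l : seq S) := forall r, ev r = ev l -> size l <= size r.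

Lemma reduced_exists w : exists2 l, reduced l & ev l = w.
Proof.
have ex : exists n, `[< exists2 l, size l = n & ev l = w >].
  by have [l <-] := ev_surj w; exists (size l); apply/asboolP; exists l.
have [n /asboolP [l <- lw] min] := ex_minnP ex.
by exists l => // r rl; apply: min; apply/asboolP; exists r => //; rewrite rl.
Qed.

Lemma exchange i l : reduced l -> ~ reduced (i :: l) ->
  exists l1 j l2, l = l1 ++ j :: l2 /\ s i ** ev l = ev (l1 ++ l2).
Proof.
move=> lred nred; have [eta [eta1 etaE]] := reflection_cocycle.
have del := deletion eta1 etaE.
have [/del //|etaF] := boolP (eta (ev l) (s i)).
(* Now [s i] is counted for [s i ** ev l]. Deleting a letter from [l'] gives a word for [ev l], so
   [l'] is at least as long as [i :: l], which would then be reduced. *)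
have [l' l'red l'E] := reduced_exists (s i ** ev l).
have /del [l1 [j [l2 [e e']]]] : eta (ev l') (s i).
  by rewrite l'E etaE cox_genK gmul1 addbC asboolT // addbT.
have := lred (l1 ++ l2); rewrite -e' l'E !cox_genE => /(_ erefl) short.
case: nred => r rE; rewrite (leq_trans _ (l'red r _)) ?l'E ?rE //=.
by apply: leq_ltn_trans short _; rewrite e !size_cat addnS.
Qed.

Lemma reduced_deletion i l l1 j l2 : reduced l -> l = l1 ++ j :: l2 ->
  s i ** ev l = ev (l1 ++ l2) -> reduced (l1 ++ l2).
Proof.
move=> lred e e' r rE; have := lred (i :: r).
rewrite /= rE -e' !cox_genE => /(_ erefl).
by rewrite e !size_cat addnS ltnS.
Qed.

(** Letters are added on the left; when reducedness fails, the exchange condition only deletes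
    letters. *)
Lemma reduced_subword l : exists r, [/\ reduced r, ev r = ev l & {subset r <= l}].
Proof.
elim: l => [|i l [r [rred rE sub]]]; first by exists [::].
have sub' : {subset i :: r <= i :: l}.
  by move=> k; rewrite !inE => /orP[->//|/sub ->]; rewrite orbT.
have [ired|nred] := pselect (reduced (i :: r)).
  by exists (i :: r); rewrite /= rE.
have [l1 [j [l2 [e e']]]] := exchange rred nred.
exists (l1 ++ l2); split; first exact: reduced_deletion rred e e'.
  by rewrite -e' rE.
move=> k kr; apply: sub'; rewrite inE e mem_cat inE.
by move: kr; rewrite mem_cat => /orP[] ->; rewrite ?orbT.
Qed.

(** * Parabolic subgroups *)

Lemma parabP (I : {set S}) w :
  parab s I w <-> exists2 l, {subset l <= I} & ev l = w.
Proof.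
split=> [[l [lI <-]]|[l lI <-]].
  elim: l lI => [|[b x] l IH] lI; first by exists [::].
  have [|r rI rE] := IH; first by move=> p pl; apply: lI; right.
  have [i iI /= xE] := lI _ (or_introl erefl).
  exists (i :: r); first by move=> k; rewrite inE => /orP[/eqP ->|/rI].
  rewrite /= -rE xE; case: b {lI} => //.
  by rewrite (grp_inv_uniq (cox_genK i)).
exists [seq (false, s i) | i <- l]; split; last by elim: l {lI} => //= i l ->.
elim: l lI => [|i l IH] lI p //= [<-|pl]; first by exists i => //; apply: lI; rewrite mem_head.
by apply: IH pl => k kl; apply: lI; rewrite inE kl orbT.
Qed.

Lemma parab_one I : parab s I gone.
Proof. by apply/parabP; exists [::]. Qed.

Lemma parab_gen (I : {set S}) i : i \in I -> parab s I (s i).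
Proof.
move=> iI; apply/parabP; exists [:: i]; last by rewrite /= grp_mulg1.
by move=> k; rewrite inE => /eqP ->.
Qed.

Lemma parab_mul I x y : parab s I x -> parab s I y -> parab s I (x ** y).
Proof.
move=> /parabP[l lI <-] /parabP[r rI <-]; apply/parabP; exists (l ++ r); last exact: ev_cat.
by move=> k; rewrite mem_cat => /orP[/lI|/rI].
Qed.

Lemma parab_ind (I : {set S}) (P : W -> Prop) :
  P gone -> (forall i x, i \in I -> P x -> P (s i ** x)) -> forall x, parab s I x -> P x.
Proof.
move=> P1 PM x /parabP [l lI <-]; elim: l lI => //= i l IH lI.
apply: PM; first by apply: lI; rewrite mem_head.
by apply: IH => k kl; apply: lI; rewrite inE kl orbT.
Qed.

Lemma parab_sub (I J : {set S}) : I \subset J -> forall x, parab s I x -> parab s J x.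
Proof.
move=> /subsetP IJ; apply: parab_ind => [|i x iI xJ]; first exact: parab_one.
by apply: parab_mul xJ; apply: parab_gen; apply: IJ.
Qed.

Lemma parab_reduced I w : parab s I w -> exists l, [/\ reduced l, ev l = w & {subset l <= I}].
Proof.
move=> /parabP[l lI <-]; have [r [rred rE sub]] := reduced_subword l.
by exists r; split=> // k /sub/lI.
Qed.

(** A reduced word for [s i] with letters in [I] has length one because [s i] is nontrivial, and its
    letter is [i] because [s] is injective. *)
Lemma gen_in_parab I i : parab s I (s i) -> i \in I.
Proof.
move=> /parab_reduced [[|j [|k l]] [red]] //=.
- by move=> /esym/cox_gen_neq1.
- by rewrite grp_mulg1 => /cox_gen_inj <-; apply; rewrite mem_head.
- by move=> e; have := red [:: i]; rewrite /= e grp_mulg1 => /(_ erefl).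
Qed.

Lemma parab_subE (I J : {set S}) :
  (forall x, parab s I x -> parab s J x) -> I \subset J.
Proof. by move=> IJ; apply/subsetP => i /parab_gen/IJ/gen_in_parab. Qed.

Lemma parab_inj (I J : {set S}) : (forall x, parab s I x <-> parab s J x) -> I = J.
Proof.
by move=> IJ; apply/eqP; rewrite eqEsubset; apply/andP; split; apply: parab_subE => x /IJ.
Qed.

(** * Longest elements *)

Lemma has_length_reduced l : reduced l -> has_length s (ev l) (size l).
Proof. by move=> red; split; [exists l | move=> r /red]. Qed.

Lemma cat_eq_cat_cons (T : Type) (l r l1 l2 : seq T) j : l ++ r = l1 ++ j :: l2 ->
  (exists r1, l = l1 ++ j :: r1 /\ l2 = r1 ++ r) \/
  (exists r1, l1 = l ++ r1 /\ r = r1 ++ j :: l2).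
Proof.
elim: l l1 => [|a l IH] [|b l1] /=; try by right; eexists.
  by move=> [-> <-]; left; exists l.
move=> [-> /IH [[r1 [-> ->]]|[r1 [-> ->]]]]; first by left; exists r1.
by right; exists r1.
Qed.

(** Induction on [l]: given [w = ev (l ++ r)], maximality forces an exchange when [i] is put in
    front. The deleted letter lies in [r], and what remains of [r] completes [i :: l]. *)
Lemma longest_prefix J w l : is_longest s J w -> reduced l -> {subset l <= J} ->
  exists2 r, w = ev (l ++ r) & reduced (l ++ r).
Proof.
move=> [wJ [n [[_ wn] max]]]; elim: l => [|i l IH] lred lJ.
  by have [r rred rw] := reduced_exists w; exists r.
have lred' : reduced l.
  by move=> r rE; have := lred (i :: r); rewrite /= rE ltnS; apply.
have [|r wE lr] := IH lred'; first by move=> k kl; apply: lJ; rewrite inE kl orbT.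
have nred : ~ reduced (i :: l ++ r).
  move=> /has_length_reduced len; have := max _ _ _ len.
  rewrite /= -wE => /(_ (parab_mul (parab_gen _) wJ)).
  by rewrite leqNgt ltnS lJ ?mem_head // wn // => /(_ isT).
have [l1 [j [l2 [e e']]]] := exchange lr nred.
have [[r1 [l1E l2E]]|[r1 [l1E rE]]] := cat_eq_cat_cons e; last first.
  exists (r1 ++ l2).
    by rewrite /= catA -l1E -e' !cox_genE wE.
  move=> r' r'E; rewrite [size _](_ : _ = size (l ++ r)).
    by apply: lr; rewrite r'E /= catA -l1E -e' !cox_genE.
  by rewrite rE /= !size_cat /= !addnS.
(* A deletion inside [l] would, after cancelling [r], contradict that [i :: l] is reduced. *)
have e1 : s i ** ev l = ev (l1 ++ r1).
  by move: e'; rewrite l2E catA !ev_cat gmulA => /grp_mulIg.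
have := lred _ (esym e1).
by rewrite /= l1E !size_cat /= addnS ltnNge leqnSn.
Qed.

Lemma longest_uniq J w w' : is_longest s J w -> is_longest s J w' -> w = w'.
Proof.
move=> wlong [w'J [n [[_ w'n] max]]].
have [l [lred lw' lJ]] := parab_reduced w'J.
have [r wE lr] := longest_prefix wlong lred lJ.
have [wJ _] := wlong; rewrite wE in wJ.
have := leq_trans (max _ _ wJ (has_length_reduced lr)) (w'n _ lw').
by rewrite size_cat -{2}[size l]addn0 leq_add2l leqn0 size_eq0 => /eqP r0; rewrite wE r0 cats0.
Qed.

(** If [v] is a reduced word for [s i ** w] and [v ++ r] one for [w], then [r] spells the conjugate
    of [s i]; comparison with the word [i :: v] for [w] bounds its length by one. *)
Lemma longest_conj J w i : is_longest s J w -> w ** w = gone -> i \in J ->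
  exists2 j, j \in J & s j = w ** (s i ** w).
Proof.
move=> wlong ww iJ; have [wJ _] := wlong.
have [v [vred vE vJ]] := parab_reduced (parab_mul (parab_gen iJ) wJ).
have [r wE vr] := longest_prefix wlong vred vJ.
have rE : ev r = w ** (s i ** w).
  by apply: (@grp_mulgI _ (ev v)); rewrite -ev_cat -wE vE gmulA mul_involK // !cox_genE.
have := vr (i :: v); rewrite /= vE !cox_genE => /(_ wE).
rewrite size_cat -addn1 leq_add2l.
case: r rE {wE vr} => [|j [|//]] /= rE _.
  case: (@cox_gen_neq1 i); rewrite -(mul_involK (s i) ww).
  by rewrite -[s i ** w](mul_involKV _ ww) -rE grp_mulg1.
rewrite grp_mulg1 in rE.
exists j; last by rewrite -gmulA.
by apply: gen_in_parab; rewrite rE; do 2?apply: parab_mul => //; apply: parab_gen.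
Qed.

Lemma conj_eqC w x y : w ** w = gone -> x = w ** (y ** w) -> y = w ** (x ** w) :> W.
Proof. by move=> ww ->; rewrite !gmulA ww gmul1 mul_involK. Qed.

Lemma conj_mul w x y : w ** w = gone ->
  w ** (x ** w) ** (w ** (y ** w)) = w ** (x ** y ** w) :> W.
Proof. by move=> ww; rewrite !gmulA mul_involK. Qed.

Lemma parab_conj_sub (I K : {set S}) w : w ** w = gone ->
  (forall i, i \in I -> exists2 t, t \in K & s t = w ** (s i ** w)) ->
  forall x, parab s I x -> parab s K (w ** x ** w).
Proof.
move=> ww IK; apply: parab_ind => [|i x iI xK]; first by rewrite grp_mulg1 ww; apply: parab_one.
have [t tK tE] := IK i iI.
have -> : w ** (s i ** x) ** w = s t ** (w ** x ** w).
  by rewrite tE !gmulA mul_involK.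
by apply: parab_mul xK; apply: parab_gen.
Qed.

Lemma parab_conj (I K : {set S}) w : w ** w = gone ->
  (forall i, i \in I -> exists2 t, t \in K & s t = w ** (s i ** w)) ->
  (forall t, t \in K -> exists2 i, i \in I & s t = w ** (s i ** w)) ->
  forall x, parab s K (w ** x ** w) <-> parab s I x.
Proof.
move=> ww IK KI x; split; last exact: parab_conj_sub.
rewrite -{2}(invol_conjK x ww); apply: parab_conj_sub => // t /KI [i iI tE].
by exists i => //; apply: conj_eqC.
Qed.

(** A commuting decomposition of [K] pulls back along conjugation by [w]. This makes [w_J(I)] an
    index of a cactus generator. *)
Lemma connected_conj (I K : {set S}) w : w ** w = gone ->
  (forall i, i \in I -> exists2 t, t \in K & s t = w ** (s i ** w)) ->
  (forall t, t \in K -> exists2 i, i \in I & s t = w ** (s i ** w)) ->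
  connected s I -> connected s K.
Proof.
move=> ww IK KI [/set0Pn [i0 i0I] [l lI] indec]; split.
- by have [t tK _] := IK _ i0I; apply/set0Pn; exists t.
- exists [seq w ** x ** w | x <- l] => x xK.
  rewrite -(invol_conjK x ww); apply: (List.in_map (fun x => w ** x ** w)); apply: lI.
  by apply/(parab_conj ww IK KI); rewrite invol_conjK.
move=> [J [L [JL JIL J0 L0 comm]]]; case: indec.
pose pull (A : {set S}) := [set i in I | `[< exists2 t, t \in A & s t = w ** (s i ** w) >]].
have pullP (A : {set S}) i : i \in pull A -> exists2 t, t \in A & s t = w ** (s i ** w).
  by rewrite inE => /andP[_ /asboolP].
have pull0 (A : {set S}) : A \subset K -> A != set0 -> pull A != set0.
  move=> /subsetP AK /set0Pn [t tA]; have [i iI tE] := KI _ (AK _ tA).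
  by apply/set0Pn; exists i; rewrite inE iI; apply/asboolP; exists t.
exists (pull J), (pull L); split.
- apply/setP => i; rewrite !inE -andb_orr; apply/andP/idP => [[]//|iI]; split=> //.
  have [t tK tE] := IK _ iI; move: tK; rewrite -JL inE => /orP[] tA; apply/orP; [left|right].
    by apply/asboolP; exists t.
  by apply/asboolP; exists t.
- apply/setP => i; rewrite !in_set0 in_setI; apply/andP => -[/pullP[t tJ tE] /pullP[t' tL]].
  rewrite -tE => /cox_gen_inj t't; have : t \in J :&: L by rewrite inE tJ -t't.
  by rewrite JIL inE.
- by apply: pull0 => //; rewrite -JL subsetUl.
- by apply: pull0 => //; rewrite -JL subsetUr.
move=> i k /pullP[t tJ /(conj_eqC ww) ->] /pullP[t' tL /(conj_eqC ww) ->].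
by rewrite !conj_mul // comm.
Qed.

End CoxeterTheory.

(** * The cactus group of a Coxeter system *)

Section PureCactus.
Variables (S : finType) (W : grp) (s : S -> W) (m : S -> S -> nat).
Hypothesis WP : is_coxeter_system s m.
Variables (C : grp) (gamma : FS s -> C).
Hypothesis CP : is_presentation gamma (@cactus_rel S W s).
Variable g : C -> W.
Hypotheses (gM : is_hom g) (g_longest : forall I, is_longest s (proj1_sig I) (g (gamma I))).
Variables (WW : grp) (tau : SSidx s -> WW).
Hypothesis WWP : is_presentation tau (@racg_rel S W s).

Implicit Types I J K : FS s.
Local Notation supp I := (proj1_sig I).
Local Notation u I := (g (gamma I)).

Lemma FS_eq I J : supp I = supp J -> I = J.
Proof.
by case: I J => [I cI] [J cJ] /= e; subst J; congr exist; apply: Prop_irrelevance.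
Qed.

Lemma cactus_genK I : gamma I ** gamma I = gone.
Proof.
have [_ rel _] := CP.
by have := rel [:: (false, I); (false, I)] [::] (or_introl _ (ex_intro _ I (conj erefl erefl)));
  rewrite /= grp_mulg1.
Qed.

Lemma cactus_comm I J K :
  supp I \subset supp J \/
    direct_prod (parab s (supp I)) (parab s (supp J)) (parab s (supp I :|: supp J)) ->
  (forall t, t \in supp K <-> exists2 i, i \in supp I & s t = u J ** (s i ** u J)) ->
  gamma I ** gamma J = gamma J ** gamma K.
Proof.
move=> IJ KE; have [_ rel _] := CP.
have := rel [:: (false, I); (false, J)] [:: (false, J); (false, K)].
by rewrite /= !grp_mulg1; apply; right; exists I, J, K, (u J).
Qed.

(** That [w_I] is an involution is read off from the cactus relation through [g]. *)
Lemma uK I : u I ** u I = gone.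
Proof. by rewrite -gM cactus_genK (hom_one gM). Qed.

Lemma u_parab I : parab s (supp I) (u I).
Proof. by have [] := g_longest I. Qed.

Lemma cactus_ind (P : C -> Prop) :
  P gone -> (forall c I, P c -> P (c ** gamma I)) -> forall c, P c.
Proof. apply: (presentation_ind CP); exact: cactus_genK. Qed.

(** For [w = w_J] this is [w_J(I)] as a set of indices; conjugates that are not generators are left
    out. *)
Definition conj_set (I : {set S}) (w : W) : {set S} :=
  [set t | `[< exists2 i, i \in I & s t = w ** (s i ** w) >]].

Lemma conj_setP (I : {set S}) w t :
  t \in conj_set I w <-> exists2 i, i \in I & s t = w ** (s i ** w).
Proof. by rewrite inE; split=> /asboolP. Qed.

Lemma sub_conj I J i : supp I \subset supp J -> i \in supp I ->
  exists t, s t = u J ** (s i ** u J).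
Proof.
move=> /subsetP IJ /IJ iJ.
by have [t _ tE] := longest_conj WP (g_longest J) (uK J) iJ; exists t.
Qed.

Lemma conj_FS I J : supp I \subset supp J ->
  exists K, forall t, t \in supp K <-> exists2 i, i \in supp I & s t = u J ** (s i ** u J).
Proof.
move=> IJ; suff cK : connected s (conj_set (supp I) (u J)).
  by exists (exist _ _ cK) => t; apply: conj_setP.
apply: (connected_conj WP (uK J)) (proj2_sig I) => [i iI|t /conj_setP //].
have [t tE] := sub_conj IJ iI.
by exists t => //; apply/conj_setP; exists i.
Qed.

Lemma parab_conj_FS I J K :
  (forall i, i \in supp I -> exists t, s t = u J ** (s i ** u J)) ->
  (forall t, t \in supp K <-> exists2 i, i \in supp I & s t = u J ** (s i ** u J)) ->
  forall x, parab s (supp K) (u J ** x ** u J) <-> parab s (supp I) x.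
Proof.
move=> ex KE; apply: (parab_conj WP (uK J)) => [i iI|t /KE //].
have [t tE] := ex i iI.
by exists t => //; apply/KE; exists i.
Qed.

(** * Subgroups in SS and the right-angled generators *)

Lemma SSsubE w I x : SSsub (w, I) x <-> parab s (supp I) (ginv w ** x ** w).
Proof.
split=> [[y /= yI ->]|xI]; first by rewrite !gmulA gmulV gmul1 grp_mulgVK.
by exists (ginv w ** x ** w); rewrite //= !gmulA grp_mulgV gmul1 grp_mulgK.
Qed.

Lemma SSsub_mulE w z I x : z ** z = gone ->
  SSsub (w ** z, I) x <-> parab s (supp I) (z ** (ginv w ** x ** w) ** z).
Proof. by move=> zz; rewrite SSsubE grp_invMg (grp_inv_uniq zz) !gmulA. Qed.

(** With [SSsub_mulE], this shows that replacing [w] by [w ** z] keeps the conjugate of [W_I] by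
    [w]; [parab_central] does the same for a [z] commuting with [W_I]. *)
Lemma parab_absorb (I : {set S}) z x : z ** z = gone -> parab s I z ->
  parab s I (z ** x ** z) <-> parab s I x.
Proof.
move=> zz zI; split=> xI; last by do 2?apply: (parab_mul WP).
rewrite -(invol_conjK x zz).
by do 2?apply: (parab_mul WP).
Qed.

Lemma parab_central (I : {set S}) z x : z ** z = gone ->
  (forall y, parab s I y -> z ** y = y ** z) ->
  parab s I (z ** x ** z) <-> parab s I x.
Proof.
move=> zz zC; split=> xI; last by rewrite zC // mul_involK.
have := zC _ xI; rewrite !gmulA zz gmul1 mul_involK // => e.
by move: xI; rewrite -e mul_involK.
Qed.

Lemma tau_eq a b : sub_eq (SSsub a) (SSsub b) -> tau a = tau b.
Proof.
move=> ab; have [_ rel _] := WWP.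
have := rel [:: (false, a)] [:: (false, b)].
by rewrite /= !grp_mulg1; apply; left; exists a, b.
Qed.

Lemma tauK a : tau a ** tau a = gone.
Proof.
have [_ rel _] := WWP; have := rel [:: (false, a); (false, a)] [::].
by rewrite /= !grp_mulg1; apply; right; left; exists a.
Qed.

Lemma tau_comm a b : m_is_2 (SSsub a) (SSsub b) -> tau a ** tau b = tau b ** tau a.
Proof.
move=> ab; have [_ rel _] := WWP.
have := rel [:: (false, a); (false, b); (false, a); (false, b)] [::].
rewrite /= grp_mulg1 => /(_ _)-e; rewrite -[RHS]gmul1 -e; last by right; right; exists a, b.
by rewrite !gmulA !mul_involK ?tauK.
Qed.

Lemma m_is_2C (P Q : W -> Prop) : m_is_2 P Q -> m_is_2 Q P.
Proof.
move=> [PQ|[QP|[PQ1 PQC]]]; [by right; left | by left | right; right].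
by split=> [x Qx Px|x y Qx Py]; [exact: PQ1 | exact: esym (PQC _ _ Py Qx)].
Qed.

(** Distinct supports generate distinct subgroups, so nesting becomes the strict inclusion that
    [m_is_2] asks for. *)
Lemma tau_comm_at w I J :
  supp I \subset supp J \/
    direct_prod (parab s (supp I)) (parab s (supp J)) (parab s (supp I :|: supp J)) ->
  tau (w, I) ** tau (w, J) = tau (w, J) ** tau (w, I).
Proof.
have [/FS_eq -> //|nIJ] := pselect (supp I = supp J).
move=> IJ; apply: tau_comm; case: IJ => [IJ|[_ comm triv]]; [left|right; right].
  split=> [x|]; first by rewrite !SSsubE; apply: (parab_sub WP).
  have /subsetPn [j jJ jI] : ~~ (supp J \subset supp I).
    by apply/negP => JI; apply: nIJ; apply/eqP; rewrite eqEsubset IJ.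
  exists (w ** s j ** ginv w); rewrite SSsubE grp_conjgK; first exact: (parab_gen WP).
  by move=> /(gen_in_parab WP); apply/negP.
split=> [x|x y].
  rewrite !SSsubE => xI xJ; have := triv _ xI xJ => /(congr1 (fun z => w ** z ** ginv w)).
  by rewrite !gmulA grp_mulgV gmul1 grp_mulgK grp_mulg1 grp_mulgV.
move=> [x' /= xI ->] [y' /= yJ ->].
by rewrite !grp_conj_mul (comm _ _ xI yJ).
Qed.

(** * The crossed homomorphism C_W -> WW *)

Lemma cactus_action : exists act : C -> WW * W -> WW * W,
  [/\ forall p, act gone p = p,
      forall c d p, act (c ** d) p = act d (act c p) &
      forall I p, act (gamma I) p = (p.1 ** tau (p.2, I), p.2 ** u I)].
Proof.
pose step I (p : WW * W) := (p.1 ** tau (p.2, I), p.2 ** u I).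
have stepK I : involutive (step I).
  move=> [x w]; rewrite /step /= mul_involK ?uK // -gmulA; congr pair.
  rewrite (_ : tau (w ** u I, I) = tau (w, I)) ?tauK ?grp_mulg1 //.
  apply: tau_eq => z; rewrite SSsub_mulE ?uK // SSsubE.
  by apply: parab_absorb; [exact: uK | exact: u_parab].
apply: (presentation_action CP stepK) => l r lr [x w].
case: lr (lr) => [[I [-> ->]] _|[I [J [K [wJ [IJ wJlong KE -> ->]]]]] rel /=]; first exact: stepK.
have [_ /(_ _ _ rel) /= + _] := CP.
rewrite !grp_mulg1 => /(congr1 g); rewrite !gM => uE.
rewrite /step /= -!gmulA uE; congr (_, _); congr gmul.
move: KE; rewrite (longest_uniq WP wJlong (g_longest J)) => KE.
(* Both second letters are moved back to the base point [w], where [K] becomes [I]; what remains is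
   the commutation of [tau (w, I)] and [tau (w, J)]. *)
rewrite (_ : tau (w ** u I, J) = tau (w, J)); last first.
  apply: tau_eq => y; rewrite SSsub_mulE ?uK // SSsubE; case: IJ => [IJ|[_ comm _]].
    by apply: parab_absorb; [exact: uK | apply: (parab_sub WP IJ); exact: u_parab].
  by apply: parab_central; [exact: uK | move=> z; apply: comm; exact: u_parab].
rewrite (_ : tau (w ** u J, K) = tau (w, I)); first exact: tau_comm_at.
apply: tau_eq => y; rewrite SSsub_mulE ?uK // SSsubE.
apply: parab_conj_FS => // i iI; case: IJ => [IJ|[_ comm _]]; first exact: sub_conj IJ iI.
by exists i; rewrite (comm (s i)) ?u_parab ?gmulA ?uK ?gmul1 //;
  [exact: (parab_gen WP) | exact: u_parab].
Qed.

(** * The right-angled Coxeter group acts on C_W *)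

Definition position c (P : W -> Prop) I := sub_eq P (SSsub (g c, I)).

Lemma position_uniq c P I J : position c P I -> position c P J -> I = J.
Proof.
move=> PI PJ; apply: FS_eq; apply: (parab_inj WP) => x.
by rewrite -(grp_conjgK (g c) x) -!SSsubE -PI -PJ.
Qed.

Lemma position_gen c P I : position c P I -> position (c ** gamma I) P I.
Proof.
move=> PI x; rewrite PI gM SSsub_mulE ?uK // SSsubE.
by symmetry; apply: parab_absorb; [exact: uK | exact: u_parab].
Qed.

(** Moving by the smaller [I] keeps the type of [Q], as [w_I] lies in [W_J]; moving by [J] changes
    the type of [P] from [I] to [w_J(I)]. *)
Lemma position_square_sub c P Q I J : (forall x, P x -> Q x) ->
  position c P I -> position c Q J ->
  exists I', [/\ position (c ** gamma I) Q J, position (c ** gamma J) P I' &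
                 gamma I ** gamma J = gamma J ** gamma I'].
Proof.
move=> PQ PI QJ.
have IJ : supp I \subset supp J.
  apply: (parab_subE WP) => x.
  by rewrite -(grp_conjgK (g c) x) -!SSsubE -PI -QJ; apply: PQ.
have [K KE] := conj_FS IJ.
exists K; split=> [x|x|]; last by apply: cactus_comm KE; left.
  rewrite QJ gM SSsub_mulE ?uK // SSsubE; symmetry.
  by apply: parab_absorb; [exact: uK | apply: (parab_sub WP IJ); exact: u_parab].
rewrite PI gM SSsub_mulE ?uK // SSsubE; symmetry.
by apply: parab_conj_FS => // i; apply: sub_conj.
Qed.

(** Bridges two forms of commutation: [m_is_2] gives commuting subgroups that meet trivially, while
    the cactus relation asks for a direct product. *)
Lemma parab_direct_prod (I J : {set S}) :
  (forall x, parab s I x -> parab s J x -> x = gone) ->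
  (forall x y, parab s I x -> parab s J y -> x ** y = y ** x) ->
  direct_prod (parab s I) (parab s J) (parab s (I :|: J)).
Proof.
move=> triv comm; split=> // x; split=> [|[a [b [aI [bJ ->]]]]]; last first.
  by apply: (parab_mul WP); [apply: (parab_sub WP _ aI) | apply: (parab_sub WP _ bJ)];
    rewrite ?subsetUl ?subsetUr.
move: x; apply: (parab_ind WP) => [|i y iIJ [a [b [aI [bJ ->]]]]].
  by exists gone, gone; rewrite gmul1; split; [|split=> //]; exact: (parab_one WP).
move: iIJ; rewrite inE => /orP[iI|iJ].
  exists (s i ** a), b; rewrite gmulA; split=> //.
  by apply: (parab_mul WP) aI; apply: (parab_gen WP).
exists a, (s i ** b); rewrite !gmulA (comm a (s i)) //; last exact: (parab_gen WP).
split=> //; split=> //.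
by apply: (parab_mul WP) bJ; apply: (parab_gen WP).
Qed.

(** The moves for [P] and for [Q] form a square at [c], closed by a cactus relation. *)
Lemma position_square c P Q I J : m_is_2 P Q -> position c P I -> position c Q J ->
  exists I' J', [/\ position (c ** gamma I) Q J', position (c ** gamma J) P I' &
                    gamma I ** gamma J' = gamma J ** gamma I'].
Proof.
move=> [[PQ _]|[[QP _]|[triv comm]]] PI QJ.
- by have [K [? ? ?]] := position_square_sub PQ PI QJ; exists K, J.
- by have [K [? ? ?]] := position_square_sub QP QJ PI; exists I, K.
have conjE := grp_conjgK (g c).
have inP x : parab s (supp I) x -> P (g c ** x ** ginv (g c)).
  by move=> xI; rewrite PI SSsubE conjE.
have inQ x : parab s (supp J) x -> Q (g c ** x ** ginv (g c)).
  by move=> xJ; rewrite QJ SSsubE conjE.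
have commIJ x y : parab s (supp I) x -> parab s (supp J) y -> x ** y = y ** x.
  move=> /inP xP /inQ yQ; rewrite -[x]conjE -[y]conjE; move: (comm _ _ xP yQ).
  move: (g c ** x ** _) (g c ** y ** _) => a b ba.
  by rewrite !gmulA !grp_mulgK -!(gmulA (ginv (g c))) ba.
have trivIJ x : parab s (supp I) x -> parab s (supp J) x -> x = gone.
  by move=> /inP xP /inQ xQ; rewrite -[x]conjE (triv _ xP xQ) grp_mulg1 gmulV.
exists I, J; split=> [x|x|].
- rewrite QJ gM SSsub_mulE ?uK // SSsubE; symmetry.
  by apply: parab_central; [exact: uK | move=> y; apply: commIJ; exact: u_parab].
- rewrite PI gM SSsub_mulE ?uK // SSsubE; symmetry.
  by apply: parab_central; [exact: uK | move=> y yI; rewrite (commIJ y) //; exact: u_parab].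
(* Here [w_J(I) = I], so the cactus relation is plain commutation. *)
have conjI i : i \in supp I -> u J ** (s i ** u J) = s i.
  move=> iI; rewrite (commIJ (s i)) ?gmulA ?uK ?gmul1 //; last exact: u_parab.
  exact: (parab_gen WP).
apply: cactus_comm => [|t]; first by right; apply: parab_direct_prod.
split=> [tI|[i iI]]; first by exists t => //; rewrite conjI.
by rewrite conjI // => /(cox_gen_inj WP) ->.
Qed.

(** The choice made by [cid] is immaterial by [position_uniq]. *)
Definition racg_step (a : SSidx s) (c : C) : C :=
  if pselect (exists I, position c (SSsub a) I) is left ex
  then c ** gamma (sval (cid ex)) else c.

Lemma racg_step_position a c I : position c (SSsub a) I -> racg_step a c = c ** gamma I.
Proof.
rewrite /racg_step => aI; case: pselect => [ex|[]]; last by exists I.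
by case: cid => J /= aJ; rewrite (position_uniq aI aJ).
Qed.

Lemma racg_step_id a c : ~ (exists I, position c (SSsub a) I) -> racg_step a c = c.
Proof. by rewrite /racg_step; case: pselect. Qed.

Lemma racg_stepK a : involutive (racg_step a).
Proof.
move=> c; have [[I aI]|no] := pselect (exists I, position c (SSsub a) I).
  rewrite (racg_step_position aI) (racg_step_position (position_gen aI)).
  by rewrite mul_involK // cactus_genK.
by rewrite !racg_step_id // racg_step_id.
Qed.

Lemma racg_step_comm_move a b c I : m_is_2 (SSsub a) (SSsub b) ->
  position c (SSsub a) I -> racg_step b (racg_step a c) = racg_step a (racg_step b c).
Proof.
move=> ab aI; rewrite (racg_step_position aI).
have [[J bJ]|nob] := pselect (exists J, position c (SSsub b) J).
  have [I' [J' [bJ' aI' e]]] := position_square ab aI bJ.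
  rewrite (racg_step_position bJ) (racg_step_position bJ') (racg_step_position aI').
  by rewrite -!gmulA e.
(* A position for [b] after the move would give one at [c], because the same move leads back. *)
rewrite (racg_step_id nob) (racg_step_position aI) racg_step_id // => -[J bJ].
have [I' [J' [bJ' _ _]]] := position_square ab (position_gen aI) bJ.
by apply: nob; exists J'; rewrite mul_involK ?cactus_genK in bJ'.
Qed.

Lemma racg_step_comm a b c : m_is_2 (SSsub a) (SSsub b) ->
  racg_step b (racg_step a c) = racg_step a (racg_step b c).
Proof.
move=> ab.
have [[I aI]|noa] := pselect (exists I, position c (SSsub a) I).
  exact: racg_step_comm_move aI.
have [[J bJ]|nob] := pselect (exists J, position c (SSsub b) J).
  by symmetry; apply: racg_step_comm_move bJ; apply: m_is_2C.
by rewrite (racg_step_id noa) (racg_step_id nob) (racg_step_id noa).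
Qed.

Lemma racg_action : exists act : WW -> C -> C,
  [/\ forall c, act gone c = c,
      forall x y c, act (x ** y) c = act y (act x c) &
      forall a c, act (tau a) c = racg_step a c].
Proof.
apply: (presentation_action WWP racg_stepK) => l r lr c.
case: lr => [[a [b [ab [-> ->]]]]|[[a [-> ->]]|[a [b [ab [-> ->]]]]]] /=.
- have [[I aI]|noa] := pselect (exists I, position c (SSsub a) I).
    rewrite (racg_step_position aI) (@racg_step_position b c I) // => x.
    by rewrite -ab.
  rewrite !racg_step_id // => -[I bI]; apply: noa; exists I => x.
  by rewrite ab.
- exact: racg_stepK.
by rewrite -(racg_step_comm (racg_step a c)) // racg_stepK racg_stepK.
Qed.

Lemma cactus_embedding : exists f : C -> WW,
  (forall c d, g c = gone -> f (c ** d) = f c ** f d) /\ injective f.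
Proof.
have [act [act1 actM actE]] := cactus_action.
have [ract [ract1 ractM ractE]] := racg_action.
pose f c := (act c (gone, gone)).1.
have actP c : act c (gone, gone) = (f c, g c).
  rewrite [LHS]surjective_pairing; congr pair.
  elim/cactus_ind: c => [|c I IH]; first by rewrite act1 (hom_one gM).
  by rewrite actM actE /= IH gM.
(* The action commutes with left multiplication on the first coordinate, so from [(f c, gone)] the
   element [d] leads to first coordinate [f c ** f d]. *)
have act_mul d x y w : act d (x ** y, w) = (x ** (act d (y, w)).1, (act d (y, w)).2).
  elim/cactus_ind: d => [|d I IH]; first by rewrite !act1.
  by rewrite !actM !actE IH /= gmulA.
exists f; split=> [c d gc|].
  by rewrite /f actM actP gc -{1}[f c]grp_mulg1 act_mul.
(* By induction [f c] carries [gone] to [c]; then [tau (g c, I)], whose subgroup has position [I] at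
   [c], carries [c] to [c ** gamma I]. *)
suff fK : cancel f (ract^~ gone) by exact: can_inj fK.
elim/cactus_ind => [|c I IH]; first by rewrite /f act1 ract1.
by rewrite /f actM actP actE /= ractM IH ractE (@racg_step_position _ _ I).
Qed.

End PureCactus.

Theorem theorem1
  (S : finType) (W : grp) (s : S -> W) (m : S -> S -> nat)
  (HW : is_coxeter_system s m)
  (C : grp) (gamma : FS s -> C) (HC : is_presentation gamma (@cactus_rel S W s))
  (g : C -> W) (Hg : is_hom g) (HgI : forall I : FS s, is_longest s (proj1_sig I) (g (gamma I)))
  (WW : grp) (tau : SSidx s -> WW) (HWW : is_presentation tau (@racg_rel S W s)) :
  exists f : C -> WW,
    (forall c d, g c = gone -> g d = gone -> f (gmul c d) = gmul (f c) (f d)) /\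
    (forall c d, g c = gone -> g d = gone -> f c = f d -> c = d).
Proof.
have [f [fM f_inj]] := cactus_embedding HW HC Hg HgI HWW.
by exists f; split=> c d gc gd; [exact: fM | exact: f_inj].
Qed.
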